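(* Let $k\ge5$ and $n\ge k^3$ be integers. Let $f^*(n,k)$ denote the maximum of $\min\{|\mathcal A|,|\mathcal B|\}$ over all pairs $\mathcal A,\mathcal B\subset\binom{[n]}{k}$ such that $\mathcal A\cap\mathcal B=\emptyset$, $\mathcal A$ and $\mathcal B$ are cross-intersecting, and neither $\mathcal A$ nor $\mathcal B$ is a star. Then $$f^*(n,k)=\left\lfloor\frac12\left(\binom{n-1}{n-k}-\binom{n-2k}{k-1}\right)\right\rfloor+1.$$
   Context: $[n]=\{1,\dots,n\}$ and $\binom{[n]}{k}$ is the collection of all $k$-element subsets of $[n]$. Families $\mathcal A,\mathcal B$ are cross-intersecting if $A\cap B\neq\emptyset$ for all $A\in\mathcal A$, $B\in\mathcal B$. A family $\mathcal F$ is a star if there is $x\in[n]$ with $x\in F$ for all $F\in\mathcal F$. *)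

(* Defs.v *)
From mathcomp Require Import all_boot.
Set Implicit Arguments. Unset Strict Implicit. Unset Printing Implicit Defensive.

(* Families of subsets of [n] = 'I_n (elements 0..n-1 stand for 1..n). *)

Definition k_uniform n k (F : {set {set 'I_n}}) : bool :=
  [forall A in F, #|A| == k].

Definition cross_intersecting n (F G : {set {set 'I_n}}) : bool :=
  [forall A in F, forall B in G, A :&: B != set0].

Definition is_star n (F : {set {set 'I_n}}) : bool :=
  [exists x : 'I_n, forall A in F, x \in A].

Definition admissible_pair n k (F G : {set {set 'I_n}}) : bool :=
  [&& k_uniform k F, k_uniform k G, [disjoint F & G],
      cross_intersecting F G, ~~ is_star F & ~~ is_star G].

(* f*(n,k): the maximum of min(|A|,|B|) over admissible pairs
   (0 if there is none). *)
Definition fstar n k : nat :=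
  \max_(p : {set {set 'I_n}} * {set {set 'I_n}} | admissible_pair k p.1 p.2)
     minn #|p.1| #|p.2|.

(* Main.v *)
Require Import Defs.
From mathcomp Require Import all_boot zify.
Set Implicit Arguments. Unset Strict Implicit. Unset Printing Implicit Defensive.

(* Put M = C(n-2,k-2), T = C(n-3,k-3) and N = C(n-1,k-1) - C(n-2k,k-1); n >= k^3
   gives (k^2+2k+4) T <= M and (2k-3) M <= N.  Let F, G be admissible with
   2|F|, 2|G| >= N+3.  Branching over the points of members of G bounds |F| by
   k^3 T unless some pair of points covers G, so F and G both have 2-element
   covers.  Branching again from a 2-cover of F shows that G has at least three
   2-covers; three 2-covers without a common point would force |G| <= 3M, so they
   share a center, and the centers obtained for F and for G coincide, at x say.
   If two members of F avoid x, the members of G through x are so restricted that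
   2|G| <= N.  Otherwise F and G have single members D and E avoiding x, and every
   other member of F or G is a k-set through x meeting D :|: E, a set of at most
   2k-1 points; there are at most N of these, so |F| + |G| <= N+2.  Equality is
   attained by distributing evenly all the k-sets through x meeting D :|: E, where
   |D :&: E| = 1. *)

(** * Binomial estimates *)

Lemma bin_le_shift m r j : j <= m ->
  'C(m, r.+1) <= 'C(m - j, r.+1) + j * 'C(m.-1, r).
Proof.
elim: j => [|j IHj] lt_jm; first by rewrite subn0 mul0n addn0.
apply: leq_trans (IHj (ltnW lt_jm)) _.
have -> : m - j = (m - j.+1).+1 by lia.
rewrite binS mulSn.
have : 'C(m - j.+1, r) <= 'C(m.-1, r) by apply: leq_bin2l; lia.
lia.
Qed.

(** Iterating Pascal's rule writes 'C(m, r+2) - 'C(m-j, r+2) as the sum of 'C(m-i, r+1) for i =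
    1..j, and the i-th term is at least 'C(m-1, r+1) - (i-1) 'C(m-2, r). Everything is doubled to
    avoid halving j(j-1). *)
Lemma bin_telescope_lower m r j : j < m ->
  2 * 'C(m - j, r.+2) + 2 * j * 'C(m.-1, r.+1)
    <= 2 * 'C(m, r.+2) + j * j.-1 * 'C(m.-2, r).
Proof.
elim: j => [|j IHj] lt_jm; first by rewrite subn0; lia.
have := IHj (ltnW lt_jm).
have -> : m - j = (m - j.+1).+1 by lia.
rewrite binS.
have := @bin_le_shift m.-1 r j.
have -> : m.-1 - j = m - j.+1 by lia.
have le_jm : j <= m.-1 by lia.
move=> /(_ le_jm).
case: j {IHj lt_jm le_jm} => [|j] /=; nia.
Qed.

(** The mixed second difference counts the (r+2)-sets that meet both of two disjoint blocks of k and
    j points; choosing a point in each block gives at most j k 'C(m-2, r) of them. *)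
Lemma bin_concave m r k j : k + j < m ->
  'C(m, r.+2) + 'C(m - k - j, r.+2)
    <= 'C(m - k, r.+2) + 'C(m - j, r.+2) + j * k * 'C(m.-2, r).
Proof.
elim: j => [|j IHj] lt_m; first by rewrite !subn0; lia.
have := IHj ltac:(lia).
have -> : m - k - j = (m - k - j.+1).+1 by lia.
have -> : m - j = (m - j.+1).+1 by lia.
rewrite !binS.
have := @bin_le_shift (m - j.+1) r k ltac:(lia).
have -> : m - j.+1 - k = m - k - j.+1 by lia.
have : 'C((m - j.+1).-1, r) <= 'C(m.-2, r) by apply: leq_bin2l; lia.
nia.
Qed.

(** M/T = (n-2)/(k-2), and (k-2)(k^2+2k+4) = k^3-8 is at most n-2. *)
Lemma bin_ratio n k : 5 <= k -> k ^ 3 <= n ->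
  (k ^ 2 + 2 * k + 4) * 'C(n - 3, k - 3) <= 'C(n - 2, k - 2).
Proof.
move=> hk hn.
have := mul_bin_diag (n - 2) (k - 3).
have -> : (n - 2).-1 = n - 3 by lia.
have -> : (k - 3).+1 = k - 2 by lia.
move: ('C(_, _)) ('C(_, _)) => t m eq_tm.
rewrite -(leq_pmul2l (_ : 0 < k - 2)); last lia.
rewrite -eq_tm mulnA leq_mul2r; apply/orP; right.
move: hn; rewrite !expnS expn0; nia.
Qed.

(** Telescoping over 2k-1 steps gives N >= (2k-1)M - (2k-1)(k-1)T, and the subtracted term is at
    most 2M by [bin_ratio]. *)
Lemma card_star_lower n k : 5 <= k -> k ^ 3 <= n ->
  (2 * k - 3) * 'C(n - 2, k - 2) <= 'C(n.-1, k.-1) - 'C(n - 2 * k, k.-1).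
Proof.
move=> hk hn; have := bin_ratio hk hn.
have n_big : 25 * k <= n by apply: leq_trans hn; rewrite !expnS expn0; nia.
have := @bin_telescope_lower n.-1 (k - 3) (2 * k - 1) ltac:(lia).
have -> : n.-1 - (2 * k - 1) = n - 2 * k by lia.
have -> : (k - 3).+2 = k.-1 by lia.
have -> : (k - 3).+1 = k - 2 by lia.
have -> : n.-1.-2 = n - 3 by lia.
have -> : n.-1.-1 = n - 2 by lia.
move: ('C(_, _)) ('C(_, _)) ('C(n - 2, _)) ('C(n - 3, _)) => a b m t.
have [j ->] : exists j, k = j + 5 by exists (k - 5); lia.
rewrite !expnS expn0; nia.
Qed.

(** By [bin_concave], twice the first difference exceeds N by at most k(k-1)T - 'C(n-k-1, k-2), and
    that last binomial is at least M - (k-1)T. With the extra (2k+2)T the total excess is at most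
    (k+1)^2 T - M, which is not positive. *)
Lemma card_star_half n k : 5 <= k -> k ^ 3 <= n ->
  2 * ('C(n.-1, k.-1) - 'C(n - k, k.-1)) + (2 * k + 2) * 'C(n - 3, k - 3)
    <= 'C(n.-1, k.-1) - 'C(n - 2 * k, k.-1).
Proof.
move=> hk hn; have := bin_ratio hk hn.
have n_big : 25 * k <= n by apply: leq_trans hn; rewrite !expnS expn0; nia.
have := @bin_concave n.-1 (k - 3) k k.-1 ltac:(lia).
have := @bin_le_shift (n - 2) (k - 3) k.-1 ltac:(lia).
have := binS (n - k.+1) (k - 3).+1.
have : 'C(n - 2 * k, k.-1) <= 'C(n - k, k.-1) by apply: leq_bin2l; lia.
have : 'C(n - k, k.-1) <= 'C(n.-1, k.-1) by apply: leq_bin2l; lia.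
have -> : n.-1 - k - k.-1 = n - 2 * k by lia.
have -> : n.-1 - k.-1 = n - k by lia.
have -> : n.-1 - k = n - k.+1 by lia.
have -> : (n - k.+1).+1 = n - k by lia.
have -> : n - 2 - k.-1 = n - k.+1 by lia.
have -> : (k - 3).+2 = k.-1 by lia.
have -> : (k - 3).+1 = k - 2 by lia.
have -> : (n - 2).-1 = n - 3 by lia.
have -> : n.-1.-2 = n - 3 by lia.
move: ('C(n - 2, _)) ('C(n - 3, _)) ('C(n.-1, _)) ('C(n - k, _)) ('C(n - 2 * k, _)).
move: ('C(n - k.+1, _)) ('C(n - k.+1, _)) => d c m t a b e.
have [j ->] : exists j, k = j + 5 by exists (k - 5); lia.
have -> : (j + 5).-1 = j + 4 by lia.
rewrite !expnS expn0; nia.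
Qed.

(** With m = M, t = T and f the size of a family, these are the thresholds needed later: for the
    existence of a 2-cover, for three 2-covers, for the three-pairs bound, and for absorbing
    lower-order terms. *)
Lemma large_bounds k m t f : 5 <= k -> (k ^ 2 + 2 * k + 4) * t <= m ->
    (2 * k - 3) * m < 2 * f ->
  [/\ k ^ 3 * t < f, 2 * m + 2 * k ^ 2 * t < f, 3 * m < f & k ^ 2 * t + t <= m].
Proof.
move=> hk; have [j ->] : exists j, k = j + 5 by exists (k - 5); lia.
have -> : 2 * (j + 5) - 3 = 2 * j + 7 by lia.
have -> : ((j + 5) ^ 2 + 2 * (j + 5) + 4) * t = j * j * t + 12 * (j * t) + 39 * t.
  by rewrite !expnS expn0; lia.
have -> : (j + 5) ^ 3 * t = j * j * j * t + 15 * (j * j * t) + 75 * (j * t) + 125 * t.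
  by rewrite !expnS expn0; lia.
have -> : 2 * (j + 5) ^ 2 * t = 2 * (j * j * t) + 20 * (j * t) + 50 * t.
  by rewrite !expnS expn0; lia.
have -> : (j + 5) ^ 2 * t = j * j * t + 10 * (j * t) + 25 * t.
  by rewrite !expnS expn0; lia.
rewrite mulnDl -(mulnA 2) => ratio large.
(* The cubic term of the first bound is reached through [j] times the ratio; with monomials as atoms
   the rest is linear. *)
have := leq_mul (leqnn j) ratio.
have -> : j * (j * j * t + 12 * (j * t) + 39 * t)
            = j * j * j * t + 12 * (j * j * t) + 39 * (j * t) by lia.
move: (j * j * j * t) (j * j * t) (j * t) (j * m) ratio large => a b c d.
by split; lia.
Qed.

(** * Counting k-sets with prescribed and forbidden points *)

Lemma card_supersets (T : finType) k (U D : {set T}) :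
    [disjoint U & D] -> #|U| <= k ->
  #|[set A : {set T} | [&& #|A| == k, U \subset A & [disjoint A & D]]]|
    = 'C(#|T| - #|U| - #|D|, k - #|U|).
Proof.
move=> dUD leUk.
have cardC : #|~: (U :|: D)| = #|T| - #|U| - #|D|.
  by rewrite cardsCs setCK cardsU disjoint_setI0 // cards0 subn0 subnDA.
rewrite -cardC -cards_draws.
have disj_draw (E : {set T}) : E \subset ~: (U :|: D) -> 
    [disjoint E & U] /\ [disjoint E & D].
  rewrite setCU subsetI -!setTD !subsetD => /andP[/andP[_ dU] /andP[_ dD]].
  by split.
(* Adjoining U is a bijection from the (k - #|U|)-subsets of the complement of U :|: D onto the sets
   counted. *)
rewrite -[RHS](@card_in_imset _ _ (fun E => E :|: U)); last first.
  move=> E F; rewrite !inE => /andP[/disj_draw[dE _] _] /andP[/disj_draw[dF _] _] eqEF.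
  have drop_U (X : {set T}) : [disjoint X & U] -> (X :|: U) :\: U = X.
    by move=> dX; rewrite setDUl setDv setU0; apply/setDidPl.
  by rewrite -(drop_U E dE) eqEF drop_U.
congr #|pred_of_set _|; apply/setP=> A; rewrite inE; apply/and3P/imsetP.
  case=> /eqP cA sUA dAD; exists (A :\: U); last first.
    apply/setP=> z; rewrite !inE.
    by case: (boolP (z \in U)) => [/(subsetP sUA) ->|]; rewrite ?orbT ?orbF.
  rewrite inE cardsD (setIidPr sUA) cA eqxx andbT.
  apply/subsetP=> z; rewrite !inE negb_or => /andP[-> zA] /=.
  by apply: contraTN zA => zD; rewrite (disjointFl dAD).
case=> E; rewrite inE => /andP[/disj_draw[dE dD] /eqP cE] ->; split.
- by rewrite cardsU disjoint_setI0 // cards0 subn0 cE subnK.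
- exact: subsetUr.
- by rewrite -setI_eq0 setIUl setU_eq0 !setI_eq0 dD dUD.
Qed.

Lemma card_star_meeting (n k : nat) (x : 'I_n) (D : {set 'I_n}) : 0 < k -> x \notin D ->
  #|[set A : {set 'I_n} | [&& #|A| == k, x \in A & A :&: D != set0]]|
    = 'C(n.-1, k.-1) - 'C(n.-1 - #|D|, k.-1).
Proof.
move=> k_gt0 xD.
have d0 : [disjoint [set x] & (set0 : {set 'I_n})] by rewrite -setI_eq0 setI0.
have dD : [disjoint [set x] & D] by rewrite disjoints1.
have := card_supersets d0 (_ : #|[set x]| <= k); rewrite cards1 => /(_ k_gt0).
have := card_supersets dD (_ : #|[set x]| <= k); rewrite cards1 => /(_ k_gt0).
rewrite card_ord cards0 subn0 !subn1 => <- <-; rewrite -cardsDS; last first.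
  apply/subsetP=> A; rewrite !inE => /and3P[-> ->] _ /=.
  by rewrite -setI_eq0 setI0.
congr #|pred_of_set _|; apply/setP=> A; rewrite !inE -!setI_eq0 setI0 eqxx sub1set.
by case: eqP; case: (x \in A) => //=; case: eqP.
Qed.

(** * Covers and cross-intersection *)

Definition covers n (U : {set 'I_n}) (G : {set {set 'I_n}}) : bool :=
  [forall B in G, U :&: B != set0].

Definition above n (F : {set {set 'I_n}}) (U : {set 'I_n}) : {set {set 'I_n}} :=
  [set A in F | U \subset A].

(** The neighbourhood of u in the graph whose edges are the 2-point covers of G. A center is a
    vertex with at least three neighbours. *)
Definition partners n (G : {set {set 'I_n}}) (u : 'I_n) : {set 'I_n} :=
  [set w | (w != u) && covers [set u; w] G].

Lemma k_uniformP (n k : nat) (F : {set {set 'I_n}}) :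
  reflect (forall A, A \in F -> #|A| = k) (k_uniform k F).
Proof.
apply: (iffP forallP) => [unifF A AF | unifF A].
  by have /implyP/(_ AF)/eqP := unifF A.
by apply/implyP=> AF; rewrite unifF.
Qed.

Lemma coversP n (U : {set 'I_n}) (G : {set {set 'I_n}}) :
  reflect (forall B, B \in G -> exists2 w, w \in U & w \in B) (covers U G).
Proof.
apply: (iffP forallP) => [covU B BG | covU B].
  have /implyP/(_ BG)/set0Pn[w] := covU B.
  by rewrite inE => /andP[wU wB]; exists w.
apply/implyP=> /covU[w wU wB]; apply/set0Pn; exists w.
by rewrite inE wU.
Qed.

Lemma coversPn n (U : {set 'I_n}) (G : {set {set 'I_n}}) :
  reflect (exists2 B, B \in G & [disjoint U & B]) (~~ covers U G).
Proof.
apply: (iffP idP) => [|[B BG dUB]].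
  rewrite negb_forall => /existsP[B]; rewrite negb_imply negbK setI_eq0.
  by case/andP; exists B.
rewrite negb_forall; apply/existsP; exists B.
by rewrite BG /= negbK setI_eq0.
Qed.

Lemma covers2P n (u w : 'I_n) (G : {set {set 'I_n}}) :
  reflect (forall B, B \in G -> (u \in B) || (w \in B)) (covers [set u; w] G).
Proof.
apply: (iffP (coversP _ _)) => covG B /covG.
  by case=> z; rewrite !inE => /orP[] /eqP-> ->; rewrite ?orbT.
by case/orP=> ?; [exists u | exists w]; rewrite ?inE ?eqxx ?orbT.
Qed.

Lemma is_starPn n (G : {set {set 'I_n}}) :
  reflect (forall x, ~~ covers [set x] G) (~~ is_star G).
Proof.
apply: (iffP idP) => [nstar x | ncov].
  apply: contra nstar => /coversP cov; apply/existsP; exists x.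
  by apply/forallP=> B; apply/implyP=> /cov[w /set1P->].
apply/existsP=> -[x /forallP star]; have /coversP[] := ncov x.
by move=> B BG; exists x; rewrite ?inE //; apply: (implyP (star B)).
Qed.

Lemma cross_intersectingP n (F G : {set {set 'I_n}}) :
  reflect (forall A, A \in F -> covers A G) (cross_intersecting F G).
Proof.
by apply: (iffP forallP) => cFG A; [move=> AF | apply/implyP];
  [apply: (implyP (cFG A)) | apply: cFG].
Qed.

Lemma cross_intersecting_sym n (F G : {set {set 'I_n}}) :
  cross_intersecting F G -> cross_intersecting G F.
Proof.
move=> /cross_intersectingP cFG; apply/cross_intersectingP => B BG.
apply/coversP=> A /cFG/coversP/(_ B BG)[w]; by exists w.
Qed.

Lemma cross_intersecting_subl n (F F' G : {set {set 'I_n}}) :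
  F' \subset F -> cross_intersecting F G -> cross_intersecting F' G.
Proof.
move=> /subsetP sF /cross_intersectingP cFG; apply/cross_intersectingP => A.
by move/sF; apply: cFG.
Qed.

Lemma k_uniform_sub (n k : nat) (F F' : {set {set 'I_n}}) :
  F' \subset F -> k_uniform k F -> k_uniform k F'.
Proof.
by move=> /subsetP sF /k_uniformP uF; apply/k_uniformP => A /sF; apply: uF.
Qed.

(** * Branching over the points of a member of the other family *)

Lemma above0 n (F : {set {set 'I_n}}) : above F set0 = F.
Proof. by apply/setP=> A; rewrite inE sub0set andbT. Qed.

Lemma in_above2 n (F : {set {set 'I_n}}) (u w : 'I_n) A :
  (A \in above F [set u; w]) = [&& A \in F, u \in A & w \in A].
Proof. by rewrite inE subUset !sub1set. Qed.

Lemma card_above (n k : nat) (F : {set {set 'I_n}}) (U : {set 'I_n}) :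
  k_uniform k F -> #|U| <= k -> #|above F U| <= 'C(n - #|U|, k - #|U|).
Proof.
move=> /k_uniformP unifF leUk.
have d0 : [disjoint U & (set0 : {set 'I_n})] by rewrite -setI_eq0 setI0.
have := card_supersets d0 leUk; rewrite card_ord cards0 subn0 => <-.
apply/subset_leq_card/subsetP=> A; rewrite !inE => /andP[/unifF-> ->].
by rewrite eqxx -setI_eq0 setI0 /=.
Qed.

Lemma card_above2 (n k : nat) (F : {set {set 'I_n}}) (u w : 'I_n) :
  k_uniform k F -> 2 <= k -> u != w -> #|above F [set u; w]| <= 'C(n - 2, k - 2).
Proof.
move=> uF k2 neq; have c2 : #|[set u; w]| = 2 by rewrite cards2 neq.
by rewrite -c2; apply: card_above; rewrite ?c2.
Qed.

Lemma card_above_branch n (F G : {set {set 'I_n}}) (U B : {set 'I_n}) :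
  cross_intersecting F G -> B \in G ->
  #|above F U| <= \sum_(w in B) #|above F (w |: U)|.
Proof.
move=> /cross_intersectingP cFG BG.
apply: (@leq_trans #|\bigcup_(w in B) above F (w |: U)|).
  apply/subset_leq_card/subsetP=> A; rewrite inE => /andP[AF sUA].
  have /coversP/(_ B BG)[w wA wB] := cFG A AF.
  by apply/bigcupP; exists w; rewrite // inE AF subUset sub1set wA sUA.
elim/big_rec2: _ => [|w m E _ leE]; first by rewrite cards0.
by apply: leq_trans (leq_card_setU _ _) _; rewrite leq_add2l.
Qed.

(** A member B of G disjoint from U exists, so each of the k branches adds a genuinely new point to
    U. *)
Lemma card_above_branch_const (n k b : nat) (F G : {set {set 'I_n}}) (U : {set 'I_n}) :
    cross_intersecting F G -> k_uniform k G -> ~~ covers U G ->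
    (forall w, w \notin U -> #|above F (w |: U)| <= b) ->
  #|above F U| <= k * b.
Proof.
move=> cFG /k_uniformP uG /coversPn[B BG dUB] hb.
apply: leq_trans (card_above_branch U cFG BG) _.
rewrite -(uG B BG) -sum_nat_const; apply: leq_sum => w wB.
by apply: hb; rewrite (disjointFl dUB).
Qed.

Lemma card_above_noncover2 (n k : nat) (F G : {set {set 'I_n}}) (u w : 'I_n) :
    cross_intersecting F G -> k_uniform k F -> k_uniform k G -> 3 <= k ->
    u != w -> ~~ covers [set u; w] G ->
  #|above F [set u; w]| <= k * 'C(n - 3, k - 3).
Proof.
move=> cFG uF uG k3 neq ncov; apply: (card_above_branch_const cFG uG ncov) => z zU.
have c3 : #|z |: [set u; w]| = 3 by rewrite cardsU1 zU cards2 neq.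
by rewrite -c3; apply: card_above; rewrite ?c3.
Qed.

(** Without a 2-cover, no set of at most two points covers G, so branching from the empty set works
    three times: a factor k per level, and at most T sets above each triple. *)
Lemma exists_cover2 (n k : nat) (F G : {set {set 'I_n}}) :
    cross_intersecting F G -> k_uniform k F -> k_uniform k G -> 3 <= k ->
    0 < #|G| -> ~~ is_star G -> k ^ 3 * 'C(n - 3, k - 3) < #|F| ->
  exists u w, u != w /\ covers [set u; w] G.
Proof.
move=> cFG uF uG k3 /card_gt0P[B0 B0G] /is_starPn nstar large.
case: (boolP [exists u, exists w, (u != w) && covers [set u; w] G]).
  by case/existsP=> u /existsP[w /andP[]]; exists u, w.
rewrite negb_exists => /forallP ncov; suff: false by [].
move: large; rewrite ltnNge => /negP[].
rewrite -(above0 F) expnS -mulnA.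
apply: (card_above_branch_const cFG uG).
  by apply/coversPn; exists B0; rewrite // -setI_eq0 set0I.
move=> u _; rewrite setU0 expnS -mulnA.
apply: (card_above_branch_const cFG uG (nstar u)) => w; rewrite inE => neq.
rewrite expn1 setUC; apply: (card_above_noncover2 cFG) => //; first by rewrite eq_sym.
have := ncov u; rewrite negb_exists => /forallP/(_ w).
by rewrite eq_sym neq.
Qed.

(** Branch once over a B missing u: points of X cost at most M each, the other points at most kT. X
    collects the w for which the pair {u, w} may cover G. *)
Lemma card_above1 (n k : nat) (F G : {set {set 'I_n}}) (u : 'I_n) (X : {set 'I_n}) :
    cross_intersecting F G -> k_uniform k F -> k_uniform k G -> 3 <= k ->
    ~~ covers [set u] G ->
    (forall w, w != u -> w \notin X ->
       #|above F [set u; w]| <= k * 'C(n - 3, k - 3)) ->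
  #|above F [set u]| <= #|X| * 'C(n - 2, k - 2) + k ^ 2 * 'C(n - 3, k - 3).
Proof.
move=> cFG uF uG k3 /coversPn[B BG]; rewrite disjoints1 => uB hX.
apply: leq_trans (card_above_branch _ cFG BG) _.
rewrite expnS expn1 -mulnA -{2}((k_uniformP _ _ uG) B BG) -!sum_nat_const.
apply: (@leq_trans (\sum_(w in B)
  ((w \in X) * 'C(n - 2, k - 2) + k * 'C(n - 3, k - 3)))).
  apply: leq_sum => w wB; rewrite setUC.
  have neq : w != u by apply: contraNneq uB => <-.
  case: (boolP (w \in X)) => [_ | wX]; last exact: hX.
  rewrite mul1n; apply: leq_trans (leq_addr _ _).
  by apply: card_above2 => //; rewrite 1?eq_sym // ltnW.
rewrite big_split leq_add2r /=.
rewrite (bigID (fun w => w \in X)) /= [X in _ + X]big1 ?addn0; last first.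
  by move=> w /andP[_ /negbTE->].
rewrite big_mkcondl big_mkcond [leqRHS]big_mkcond; apply: leq_sum => w _.
by case: (w \in X); case: (w \in B); rewrite ?mul1n.
Qed.

(** Split F into the members through u and those avoiding u, which pass through v. No member of the
    second part lies above {u, v}, so u is dropped from the partners of v and the pair is not
    counted twice. *)
Lemma card_le_partners (n k : nat) (F G : {set {set 'I_n}}) (u v : 'I_n) :
    cross_intersecting F G -> k_uniform k F -> k_uniform k G -> 3 <= k ->
    ~~ is_star G -> covers [set u; v] F ->
  #|F| <= (#|partners G u| + #|partners G v :\ u|) * 'C(n - 2, k - 2)
            + 2 * k ^ 2 * 'C(n - 3, k - 3).
Proof.
move=> cFG uF uG k3 /is_starPn nstar /covers2P cov.
pose F' := [set A in F | u \notin A].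
have sF' : F' \subset F by apply/subsetP=> A; rewrite inE => /andP[].
have cF'G := cross_intersecting_subl sF' cFG.
have uF' := k_uniform_sub sF' uF.
have le1 := @card_above1 n k F G u (partners G u) cFG uF uG k3 (nstar u).
have le2 := @card_above1 n k F' G v (partners G v :\ u) cF'G uF' uG k3 (nstar v).
have leF : #|F| <= #|above F [set u]| + #|above F' [set v]|.
  apply: leq_trans (leq_card_setU _ _); apply/subset_leq_card/subsetP=> A AF.
  rewrite !inE !sub1set AF /=; have := cov A AF.
  by case: (u \in A).
apply: leq_trans leF _; rewrite mulnDl mul2n -addnn mulnDl addnACA.
apply: leq_add; [apply: le1 | apply: le2] => w neq.
  rewrite inE neq /= => ncov; apply: card_above_noncover2 ncov => //.
  by rewrite eq_sym.
rewrite !inE neq /= negb_and negbK => /predU1P[-> | ncov].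
  rewrite (_ : above _ _ = set0) ?cards0 //; apply/setP=> A.
  by rewrite in_above2 !inE; case: (u \in A); rewrite ?andbF.
by apply: card_above_noncover2 ncov => //; rewrite eq_sym.
Qed.

(** A member through p also contains v or z; a member missing p contains both q1 and q2. *)
Lemma card_le_three_pairs (n k : nat) (G : {set {set 'I_n}}) (p q1 q2 v z : 'I_n) :
    k_uniform k G -> 2 <= k -> q1 != q2 -> v != p -> z != p ->
    covers [set p; q1] G -> covers [set p; q2] G -> covers [set v; z] G ->
  #|G| <= 3 * 'C(n - 2, k - 2).
Proof.
move=> uG k2 neq vp zp /covers2P c1 /covers2P c2 /covers2P c3.
have le1 := card_above2 uG k2 (_ : p != v).
have le2 := card_above2 uG k2 (_ : p != z).
have le3 := card_above2 uG k2 neq.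
apply: (@leq_trans (#|above G [set p; v]| + #|above G [set p; z]|
                     + #|above G [set q1; q2]|)).
  apply: leq_trans (leq_add (leq_card_setU _ _) (leqnn _)).
  apply: leq_trans (leq_card_setU _ _); apply/subset_leq_card/subsetP=> A AG.
  rewrite !inE !subUset !sub1set AG /=.
  have := c1 A AG; have := c2 A AG; have := c3 A AG.
  by case: (p \in A) => /= [|_ -> ->]; rewrite ?orbT // => ->.
by rewrite !mulSn addn0 addnA !leq_add // ?le1 ?le2 // eq_sym.
Qed.

(** * Centers: existence and uniqueness *)

Lemma partners_sub n (G : {set {set 'I_n}}) (a : 'I_n) B :
  B \in G -> a \notin B -> partners G a \subset B.
Proof.
move=> BG aB; apply/subsetP=> w; rewrite inE => /andP[_ /covers2P/(_ B BG)].
by rewrite (negbTE aB).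
Qed.

(** A member missing a must contain all partners of a, hence three fixed points. *)
Lemma card_avoiding (n k : nat) (G : {set {set 'I_n}}) (a : 'I_n) :
    k_uniform k G -> 3 <= k -> 3 <= #|partners G a| ->
  #|[set B in G | a \notin B]| <= 'C(n - 3, k - 3).
Proof.
move=> uG k3 /card_gt2P[x [y [z [[xW yW zW] [xy yz zx]]]]].
have c3 : #|x |: [set y; z]| = 3 by rewrite cardsU1 cards2 !inE yz negb_or xy eq_sym zx.
rewrite -c3; apply: leq_trans (card_above uG (_ : _ <= k)); last by rewrite c3.
apply/subset_leq_card/subsetP=> B; rewrite !inE => /andP[BG aB]; rewrite BG /=.
have /subsetP sW := partners_sub BG aB.
by rewrite !subUset !sub1set !sW.
Qed.

Lemma exists_center (n k : nat) (F G : {set {set 'I_n}}) :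
    cross_intersecting F G -> k_uniform k F -> k_uniform k G ->
    5 <= k -> k ^ 3 <= n -> ~~ is_star F -> ~~ is_star G ->
    (2 * k - 3) * 'C(n - 2, k - 2) < 2 * #|F| ->
    (2 * k - 3) * 'C(n - 2, k - 2) < 2 * #|G| ->
  exists a, 3 <= #|partners G a|.
Proof.
move=> cFG uF uG hk hn nsF nsG bigF bigG.
have [F1 F2 _ _] := large_bounds hk (bin_ratio hk hn) bigF.
have [G1 _ G3 _] := large_bounds hk (bin_ratio hk hn) bigG.
have k3 : 3 <= k by lia.
have k2 : 2 <= k by lia.
have [u [v [neq cov]]] : exists u v, u != v /\ covers [set u; v] F.
  apply: (exists_cover2 (cross_intersecting_sym cFG) uG uF) => //.
  exact: leq_ltn_trans (leq0n _) F1.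
have := card_le_partners cFG uF uG k3 nsG cov.
case: (leqP 3 #|partners G u|) => [|Wu]; first by exists u.
case: (leqP 3 #|partners G v|) => [|Wv]; first by exists v.
move=> leF; exfalso; move: G3; apply/negP; rewrite -leqNgt.
(* At least three 2-covers of G meet {u, v}. If neither point is a center, three of them without a
   common point are found, against 3M < |G|. *)
have W3 : 3 <= #|partners G u| + #|partners G v :\ u|.
  rewrite leqNgt; apply: contraTN F2 => W2; rewrite -leqNgt.
  by apply: leq_trans leF _; rewrite leq_add2r leq_mul2r -ltnS W2 orbT.
have Wvu : #|partners G v :\ u| <= #|partners G v| by apply/subset_leq_card/subsetDl.
(* Either two covers pass through u and one through v but not u, or two pass through v but not u and
   one through u. *)
have [Wu2 | Wu1] := leqP 2 #|partners G u|.
  have /card_gt1P[q1 [q2 [/setIdP[_ q1W] /setIdP[_ q2W] neqq]]] := Wu2.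
  have /card_gt0P[z] : 0 < #|partners G v :\ u| by clear -W3 Wu; lia.
  rewrite !inE => /and3P[zu zv zW].
  by apply: (card_le_three_pairs uG k2 neqq _ zu q1W q2W zW); rewrite eq_sym.
have /card_gt0P[w] : 0 < #|partners G u| by clear -W3 Wv Wvu; lia.
rewrite inE => /andP[wu wW].
have Wv2 : 1 < #|partners G v :\ u| by clear -W3 Wu1; lia.
(* If w = v, then u would be a third partner of v. *)
have wv : w != v.
  apply: contraTneq Wv2 => eq_wv; rewrite eq_wv in wW.
  have : u \in partners G v by rewrite inE neq setUC.
  by move=> uW; move: Wv; rewrite (cardsD1 u) uW; clear; lia.
have /card_gt1P[z1 [z2 [/setD1P[_ /setIdP[_ z1W]] /setD1P[_ /setIdP[_ z2W]] neqz]]] := Wv2.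
exact: (card_le_three_pairs uG k2 neqz neq wv z1W z2W wW).
Qed.

(** Suppose a and b differ. A cover {a, w} of F with w different from b would force |F| <= 2M + T:
    members through b contain a or w, and at most T avoid b. So b is the only possible partner of a
    in F, and branching at a with X = {b} gives |G| <= M + k^2 T + T <= 2M. *)
Lemma centers_eq (n k : nat) (F G : {set {set 'I_n}}) (a b : 'I_n) :
    cross_intersecting F G -> k_uniform k F -> k_uniform k G ->
    5 <= k -> k ^ 3 <= n -> ~~ is_star F ->
    (2 * k - 3) * 'C(n - 2, k - 2) < 2 * #|F| ->
    (2 * k - 3) * 'C(n - 2, k - 2) < 2 * #|G| ->
    3 <= #|partners G a| -> 3 <= #|partners F b| -> a = b.
Proof.
move=> cFG uF uG hk hn /is_starPn nsF bigF bigG Wa Wb; apply/eqP/negPn/negP => ab.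
have [_ _ F3 kT] := large_bounds hk (bin_ratio hk hn) bigF.
have [_ _ {bigF bigG}G3 _] := large_bounds hk (bin_ratio hk hn) bigG.
have tM := leq_trans (leq_addl _ _) kT.
have k3 : 3 <= k by lia.
have k2 : 2 <= k by lia.
have split_at (H : {set {set 'I_n}}) x :
    #|H| <= #|above H [set x]| + #|[set B in H | x \notin B]|.
  apply: leq_trans (leq_card_setU _ _); apply/subset_leq_card/subsetP=> B BH.
  by rewrite !inE BH sub1set orbN.
have ncov w : w != a -> w \notin [set b] -> ~~ covers [set a; w] F.
  rewrite inE => wa wb; apply/negP => /covers2P cov.
  move: F3; apply/negP; rewrite -leqNgt.
  apply: leq_trans (split_at F b) _.
  apply: (@leq_trans ('C(n - 2, k - 2) + 'C(n - 2, k - 2) + 'C(n - 3, k - 3))); last first.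
    by clear -tM; lia.
  apply: leq_add (card_avoiding uF k3 Wb).
  apply: (@leq_trans (#|above F [set b; a]| + #|above F [set b; w]|)).
    apply: leq_trans (leq_card_setU _ _); apply/subset_leq_card/subsetP=> A.
    rewrite in_setU !in_above2 inE sub1set => /andP[AF bA].
    by rewrite AF bA /=; apply: cov.
  by apply: leq_add; apply: card_above2; rewrite // eq_sym.
move: G3; apply/negP; rewrite -leqNgt.
apply: leq_trans (split_at G a) _.
apply: (@leq_trans (#|[set b]| * 'C(n - 2, k - 2) + k ^ 2 * 'C(n - 3, k - 3)
                     + 'C(n - 3, k - 3))).
  apply: leq_add (card_avoiding uG k3 Wa).
  apply: (card_above1 (cross_intersecting_sym cFG)) => // w wa wb.
  apply: card_above_noncover2 (ncov w wa wb) => //; last by rewrite eq_sym.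
  exact: cross_intersecting_sym.
by rewrite cards1; clear -kT tM; lia.
Qed.

(* Removing one point p of A1 \ A2 from A1 leaves a (k-1)-set, and the members
   of G through x missing it contain both p and a point of A2. *)
Lemma card_le_of_two_avoiding (n k : nat) (F G : {set {set 'I_n}}) (x : 'I_n) :
    cross_intersecting F G -> k_uniform k F -> k_uniform k G -> 3 <= k ->
    1 < #|[set A in F | x \notin A]| -> 3 <= #|partners G x| ->
  #|G| <= 'C(n.-1, k.-1) - 'C(n - k, k.-1) + k.+1 * 'C(n - 3, k - 3).
Proof.
move=> cFG uF uG k3 /card_gt1P[A1 [A2 [/setIdP[A1F xA1] /setIdP[A2F xA2] neqA]]] Wx.
have cA1 := k_uniformP _ _ uF A1 A1F; have cA2 := k_uniformP _ _ uF A2 A2F.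
have /subsetPn[p pA1 pA2] : ~~ (A1 \subset A2).
  by apply: contra neqA => sA; rewrite eqEcard sA cA1 cA2 /=.
have xp : x != p by apply: contraNneq xA1 => ->.
have cD : #|A1 :\ p| = k.-1 by rewrite -cA1 (cardsD1 p A1) pA1.
have xD : x \notin A1 :\ p by rewrite !inE negb_and xA1 orbT.
have := card_star_meeting (ltnW (ltnW k3)) xD; rewrite cD.
have -> : n.-1 - k.-1 = n - k by clear -k3; lia.
move=> <-.
have leP : #|above G [set x; p]| <= k * 'C(n - 3, k - 3).
  apply: card_above_noncover2 (cross_intersecting_sym cFG) _ _ _ _ _ => //.
  by apply/coversPn; exists A2; rewrite // -setI_eq0 setIUl setU_eq0 !setI_eq0 !disjoints1 xA2 pA2.
(* The members of G missing x account for the last T in the factor k+1. *)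
have := card_avoiding uG k3 Wx.
rewrite mulSn [_ + k * _]addnC => leT.
apply: leq_trans (leq_add (leqnn _) (leq_add leP leT)).
apply: leq_trans (leq_add (leqnn _) (leq_card_setU _ _)).
apply: leq_trans (leq_card_setU _ _).
apply/subset_leq_card/subsetP=> B BG.
rewrite !in_setU in_above2 !inE BG (k_uniformP _ _ uG B BG) eqxx /=.
case: (boolP (x \in B)) => xB //=; rewrite ?orbT // orbF.
case: (boolP (p \in B)) => pB; rewrite ?orbT // orbF.
have /coversP/(_ A1 A1F)[w wB wA1] :=
  cross_intersectingP _ _ (cross_intersecting_sym cFG) B BG.
apply/set0Pn; exists w; rewrite !inE wB wA1 andbT.
by apply: contraNneq pB => <-.
Qed.

(** * The upper bound *)

Lemma minn_admissible_le (n k : nat) (F G : {set {set 'I_n}}) :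
    5 <= k -> k ^ 3 <= n -> admissible_pair k F G ->
  minn #|F| #|G| <= ('C(n.-1, k.-1) - 'C(n - 2 * k, k.-1))./2 + 1.
Proof.
move=> hk hn /and5P[uF uG dFG cFG /andP[nsF nsG]].
have k3 : 3 <= k by apply: leq_trans hk.
have cGF := cross_intersecting_sym cFG.
have leN := card_star_lower hk hn; have halfN := card_star_half hk hn.
set N := 'C(n.-1, k.-1) - _ in leN halfN *.
rewrite leqNgt; apply/negP; rewrite leq_min => /andP[geF geG].
(* The negated bound reads |F| >= N./2 + 2; the worst case is N odd. *)
have bigF : N.+3 <= 2 * #|F| by clear -geF; lia.
have bigG : N.+3 <= 2 * #|G| by clear -geG; lia.
have largeF : (2 * k - 3) * 'C(n - 2, k - 2) < 2 * #|F|.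
  by apply: leq_ltn_trans leN _; clear -bigF; lia.
have largeG : (2 * k - 3) * 'C(n - 2, k - 2) < 2 * #|G|.
  by apply: leq_ltn_trans leN _; clear -bigG; lia.
have [x Wx] := exists_center cFG uF uG hk hn nsF nsG largeF largeG.
have [y Wy] := exists_center cGF uG uF hk hn nsG nsF largeG largeF.
have eq_xy := centers_eq cFG uF uG hk hn nsF largeF largeG Wx Wy.
rewrite -{y}eq_xy in Wy.
have small c : c <= 'C(n.-1, k.-1) - 'C(n - k, k.-1) + k.+1 * 'C(n - 3, k - 3) ->
    N.+3 <= 2 * c -> False.
  by move: ('C(n.-1, _) - 'C(n - k, _)) halfN => d; clear; lia.
have [Fle1 | F2] := leqP #|[set A in F | x \notin A]| 1; last first.
  exact: small (card_le_of_two_avoiding cFG uF uG k3 F2 Wx) bigG.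
have [Gle1 | G2] := leqP #|[set A in G | x \notin A]| 1; last first.
  exact: small (card_le_of_two_avoiding cGF uG uF k3 G2 Wy) bigF.
have /coversPn[D DF] := is_starPn _ nsF x; rewrite disjoints1 => xD.
have /coversPn[E EG] := is_starPn _ nsG x; rewrite disjoints1 => xE.
have cD := k_uniformP _ _ uF D DF; have cE := k_uniformP _ _ uG E EG.
(* The common point of D and E saves one, so n-1-(2k-1) = n-2k points are left outside x and D :|:
   E. *)
have cDE : #|D :|: E| <= 2 * k - 1.
  have /coversP/(_ E EG)[w wD wE] := cross_intersectingP _ _ cFG D DF.
  have : 0 < #|D :&: E| by apply/card_gt0P; exists w; rewrite inE wD.
  by rewrite cardsU cD cE; clear; lia.
have xDE : x \notin D :|: E by rewrite inE negb_or xD.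
have := card_star_meeting (ltnW (ltnW k3)) xDE; set S := [set _ | _] => cS.
have leS : #|S| <= N.
  rewrite cS leq_sub2l //; apply: leq_bin2l.
  by move: cDE; clear -k3; lia.
(* A member of F meets E and a member of G meets D, so those through x lie in S. *)
have sub : F :|: G \subset S :|: ([set A in F | x \notin A] :|: [set A in G | x \notin A]).
  apply/subsetP=> A; rewrite !inE; case/orP=> AH; rewrite AH ?orbT /=;
    case: (boolP (x \in A)) => xA //=; rewrite ?orbT // ?andbF ?orbF.
    rewrite (k_uniformP _ _ uF A AH) eqxx /= setIUr setU_eq0 negb_and orbC.
    by have /forallP/(_ E)/implyP/(_ EG) -> := cross_intersectingP _ _ cFG A AH.
  rewrite (k_uniformP _ _ uG A AH) eqxx /= setIUr setU_eq0 negb_and.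
  by have /forallP/(_ D)/implyP/(_ DF) -> := cross_intersectingP _ _ cGF A AH.
have cFG0 : #|F :|: G| = #|F| + #|G|.
  by rewrite cardsU disjoint_setI0 // cards0 subn0.
have : #|F| + #|G| <= N + (1 + 1).
  rewrite -cFG0; apply: leq_trans (subset_leq_card sub) _.
  apply: leq_trans (leq_card_setU _ _) (leq_add leS _).
  by apply: leq_trans (leq_card_setU _ _) (leq_add Fle1 Gle1).
by move: bigF bigG; clear; lia.
Qed.

(** * The extremal pair *)

Lemma exists_intermediate_set (T : finType) (Y Z : {set T}) m :
    Y \subset Z -> #|Y| <= m <= #|Z| ->
  exists S : {set T}, [/\ Y \subset S, S \subset Z & #|S| = m].
Proof.
move=> sYZ; elim: m => [|m IHm] /andP[leY leZ].
  by exists Y; split=> //; apply/eqP; rewrite -leqn0.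
move: leY; rewrite leq_eqVlt => /predU1P[eqY | ltY]; first by exists Y.
have [|S [sYS sSZ cS]] := IHm; first by rewrite -ltnS ltY ltnW.
have /subsetPn[z zZ zS] : ~~ (Z \subset S).
  by apply: contraL leZ => /subset_leq_card; rewrite cS -leqNgt.
exists (z |: S); split; last by rewrite cardsU1 zS cS.
  exact: subset_trans sYS (subsetUr _ _).
by rewrite subUset sub1set zZ.
Qed.

(* The k-sets through x meeting D and not E must go to G, those meeting E and not
   D must go to F; as these two classes have the same size, distributing the
   remaining ones balances F and G. *)
Lemma exists_balanced_pair (n k : nat) (x : 'I_n) (D E : {set 'I_n}) :
    1 < k -> #|D| = k -> #|E| = k -> #|D :&: E| = 1 -> x \notin D :|: E ->
  exists F G : {set {set 'I_n}}, admissible_pair k F G /\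
    ('C(n.-1, k.-1) - 'C(n - 2 * k, k.-1))./2 + 1 <= minn #|F| #|G|.
Proof.
move=> k1 cD cE cDE xDE; have k0 := ltnW k1.
have /andP[xD xE] : (x \notin D) && (x \notin E) by rewrite -negb_or -in_setU.
pose St H := [set A : {set 'I_n} | [&& #|A| == k, x \in A & A :&: H != set0]].
have cSt (H : {set _}) : x \notin H -> #|St H| = 'C(n.-1, k.-1) - 'C(n.-1 - #|H|, k.-1).
  exact: card_star_meeting.
have cU : #|D :|: E| = 2 * k - 1 by rewrite cardsU cD cE cDE; clear; lia.
have StU : St (D :|: E) = St D :|: St E.
  apply/setP=> A; rewrite !inE setIUr setU_eq0 negb_and.
  by case: (_ == k) => //=; case: (x \in A).
have cN : #|St (D :|: E)| = 'C(n.-1, k.-1) - 'C(n - 2 * k, k.-1).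
  by rewrite cSt // cU; congr (_ - 'C(_, _)); clear -k1; lia.
rewrite -cN; set N := #|_|.
have sDZ : St D \subset St (D :|: E) by rewrite StU subsetUl.
have sEZ : St E \subset St (D :|: E) by rewrite StU subsetUr.
have eqDE : #|St D| = #|St E| by rewrite !cSt // cD cE.
have cY : #|St E :\: St D| = N - #|St D|.
  by rewrite /N -(cardsDS sDZ) StU setDUl setDv set0U.
have leDN : #|St D| <= N by apply: subset_leq_card.
have geN : N <= #|St D| + #|St E| by rewrite /N StU leq_card_setU.
(* St E :\: St D has N - #|St D| members; since #|St D| = #|St E| >= N/2, the target N./2 lies
   between its size and that of St E. *)
have [||S [sYS sSE cS]] := @exists_intermediate_set _ (St E :\: St D) (St E) N./2.
- exact: subsetDl.
- by rewrite cY -eqDE; move: leDN geN; rewrite -eqDE; clear; lia.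
have sSZ := subset_trans sSE sEZ.
pose G0 := St (D :|: E) :\: S.
have sG0D : G0 \subset St D.
  apply/subsetP=> A; rewrite in_setD StU in_setU => /andP[AS /orP[] // AE].
  by apply: contraNT AS => AD; rewrite (subsetP sYS) // in_setD AD.
have memSt (H A : {set _}) : A \in St H -> [/\ #|A| = k, x \in A & A :&: H != set0].
  by rewrite inE => /and3P[/eqP].
have xS A : A \in S -> x \in A by move/(subsetP sSE)/memSt=> [].
have xG0 A : A \in G0 -> x \in A by move/(subsetP sG0D)/memSt=> [].
have neqDE : D != E by apply: contra_eq_neq cDE => ->; rewrite setIid cE neq_ltn k1 orbT.
have DS : D \notin S by apply: contra xD => /xS.
have EG0 : E \notin G0 by apply: contra xE => /xG0.
exists (D |: S), (E |: G0); split; last first.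
  rewrite leq_min !cardsU1 DS EG0 cS /G0 cardsDS // cS -/N.
  by clear; lia.
(* A common point z would lie in H. But x |: (H' :\: H) has k points because #|H :&: H'| = 1, it
   belongs to R, and it is disjoint from H. *)
have nonstar (H H' : {set 'I_n}) (R : {set {set 'I_n}}) : #|H| = k -> #|H'| = k ->
    #|H :&: H'| = 1 -> x \notin H -> x \notin H' -> St H' :\: St H \subset R ->
    ~~ is_star (H |: R).
  move=> cH cH' cHH xH xH' /subsetP sR; apply/existsP=> -[z /forallP star].
  have zH : z \in H by have := star H; rewrite setU11.
  pose A := x |: (H' :\: H).
  have AH0 : A :&: H = set0.
    apply/setP=> w; rewrite !inE; case: (boolP (w \in H)) => wH; rewrite ?andbF //= orbF andbT.
    by apply/negbTE; apply: contraNneq xH => <-.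
  have cHd : #|H' :\: H| = k.-1 by rewrite cardsD setIC cHH cH' subn1.
  have cA : #|A| = k.
    by rewrite cardsU1 cHd in_setD (negbTE xH') andbF add1n prednK.
  have AH' : A :&: H' != set0.
    rewrite -card_gt0; apply: (@leq_trans #|H' :\: H|); first by rewrite cHd -ltnS prednK.
    by apply/subset_leq_card; rewrite subsetI subsetDl subsetUr.
  have AR : A \in R.
    apply: sR; apply/setDP; split; rewrite [A \in _]inE cA eqxx setU11 //=.
    by rewrite AH0 eqxx.
  have := star A; rewrite in_setU AR orbT /= => zA.
  by have := in_set0 z; rewrite -AH0 inE zA zH.
apply/and5P; split; last (apply/andP; split).
- apply/k_uniformP=> A; rewrite in_setU1 => /predU1P[-> // | /(subsetP sSE)/memSt[] //].
- apply/k_uniformP=> A; rewrite in_setU1 => /predU1P[-> // | /(subsetP sG0D)/memSt[] //].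
- rewrite -setI_eq0; apply/eqP/setP=> A; rewrite !inE.
  apply/negbTE; apply/andP=> -[/predU1P[-> | AS] /predU1P[eqA | /andP[nAS AZ]]].
  + by rewrite eqA eqxx in neqDE.
  + by move/and3P: AZ => [_ xA _]; rewrite xA in xD.
  + by move/xS: AS; rewrite eqA (negbTE xE).
  + by rewrite AS in nAS.
- apply/cross_intersectingP=> A; rewrite in_setU1 => AF.
  apply/forallP=> B; apply/implyP; rewrite in_setU1 => BG.
  case/predU1P: AF => [-> | AS]; case/predU1P: BG => [-> | BG].
  + by rewrite -card_gt0 cDE.
  + by move/(subsetP sG0D)/memSt: BG => [_ _]; rewrite setIC.
  + by move/(subsetP sSE)/memSt: AS => [].
  + by apply/set0Pn; exists x; rewrite inE xS ?xG0.
- exact: nonstar sYS.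
- apply: (nonstar E D) => //; first by rewrite setIC.
  apply/subsetP=> A; rewrite in_setD => /andP[nAE AD].
  by rewrite in_setD (subsetP sDZ) // andbT; apply: contra nAE => /(subsetP sSE).
Qed.

Theorem theorem5p4 (n k : nat) (hk : 5 <= k) (hn : k ^ 3 <= n) :
  fstar n k = ('C(n.-1, n - k) - 'C(n - 2 * k, k.-1))./2 + 1.
Proof.
have n_big : 25 * k <= n.
  by apply: leq_trans hn; rewrite !expnS expn0; clear -hk; nia.
have -> : 'C(n.-1, n - k) = 'C(n.-1, k.-1).
  rewrite -bin_sub; last by clear -hk n_big; lia.
  by congr 'C(_, _); clear -hk n_big; lia.
apply/eqP; rewrite eqn_leq; apply/andP; split.
  by apply/bigmax_leqP => -[F G] /=; apply: minn_admissible_le.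
have n_gt0 : 0 < n by clear -hk n_big; lia.
pose x := Ordinal n_gt0.
have [||D [_ xD cD]] := @exists_intermediate_set _ set0 [set~ x] k.
- exact: sub0set.
- by rewrite cards0 cardsC1 card_ord; clear -n_big hk; lia.
have /card_gt0P[p pD] : 0 < #|D| by rewrite cD (leq_trans _ hk).
have xD' : x \notin D by apply/negP=> /(subsetP xD); rewrite !inE eqxx.
(* E contains p and avoids x and the rest of D, so it meets D exactly in p; n >= 25k leaves enough
   room. *)
have [||E [pE sE cE]] := @exists_intermediate_set _ [set p] (~: (x |: D :\ p)) k.
- by rewrite sub1set !inE negb_or eqxx andbT; apply: contraTneq pD => ->.
- have := cardsC (x |: D :\ p); rewrite cardsU1 !inE (negbTE xD') andbF card_ord.
  have := cardsD1 p D; rewrite pD cD cards1.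
  by clear -n_big hk; lia.
have DE : D :&: E = [set p].
  apply/setP=> z; rewrite !inE; apply/andP/eqP => [[zD zE] | ->].
    move/(subsetP sE): zE; rewrite !inE negb_or negb_and zD orbF negbK.
    by case/andP=> _ /eqP.
  by rewrite pD -sub1set.
have xE : x \notin E by apply/negP=> /(subsetP sE); rewrite !inE eqxx.
have [|||F [G [adm leFG]]] := @exists_balanced_pair n k x D E _ cD cE.
- by clear -hk; lia.
- by rewrite DE cards1.
- by rewrite inE negb_or xD'.
apply: leq_trans leFG _.
exact: (leq_bigmax_cond (F, G)).
Qed.
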